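(* Let $G$ be a $d$-regular graph with $d\geq 2$. Then $\chi_s(G)\geq \left\lceil \frac{d+4}{2}\right\rceil$.
   Context: All graphs are finite and simple. A $k$-colouring of $G$ is a map $f:V(G)\to\{0,1,\dots,k-1\}$ with $f(u)\neq f(v)$ for every edge $uv$. A $k$-colouring is a $k$-star colouring if every bicoloured connected subgraph (equivalently, every connected component of $G[f^{-1}(i)\cup f^{-1}(j)]$ for $i\neq j$) is a star; equivalently, no path on 4 vertices in $G$ receives only two colours. The star chromatic number $\chi_s(G)$ is the least $k$ such that $G$ admits a $k$-star colouring. *)

(* Defs.v *)
(* MathComp; [boolp] is used only to decide the existence of a star colouring. *)
From mathcomp Require Import all_boot.
From mathcomp Require Import boolp.

Set Implicit Arguments.
Unset Strict Implicit.
Unset Printing Implicit Defensive.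

Record sgraph := SGraph {
  vertex :> finType;
  edge : rel vertex;
  edge_sym : symmetric edge;
  edge_irrefl : irreflexive edge
}.

Definition regular (G : sgraph) (d : nat) : Prop :=
  forall v : G, #|[set u | edge v u]| = d.

(* Subgraphs are not necessarily induced. *)
Record subgraph (G : sgraph) := Subgraph {
  sub_vertices : {set G};
  sub_edge : rel G;
  sub_edge_sym : symmetric sub_edge;
  sub_edgeP : forall x y, sub_edge x y ->
    [&& edge x y, x \in sub_vertices & y \in sub_vertices]
}.

Definition connected (G : sgraph) (H : subgraph G) : Prop :=
  sub_vertices H != set0 /\
  {in sub_vertices H &, forall x y, connect (sub_edge H) x y}.

(* K_{1,n} with n >= 0: an isolated vertex and a single edge are stars. *)
Definition star (G : sgraph) (H : subgraph G) : Prop :=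
  exists2 c, c \in sub_vertices H &
    {in sub_vertices H &, forall x y,
      sub_edge H x y = (x != y) && ((x == c) || (y == c))}.

Definition colouring (G : sgraph) (k : nat) (f : G -> 'I_k) : Prop :=
  forall u v : G, edge u v -> f u != f v.

Definition bicoloured (G : sgraph) (k : nat) (f : G -> 'I_k)
    (H : subgraph G) : Prop :=
  #|f @: sub_vertices H| = 2.

Definition star_colouring (G : sgraph) (k : nat) (f : G -> 'I_k) : Prop :=
  colouring f /\
  forall H : subgraph G, bicoloured f H -> connected H -> star H.

Definition star_colourable (G : sgraph) (k : nat) : Prop :=
  exists f : G -> 'I_k, star_colouring f.

Lemma ex_star_colourable (G : sgraph) : exists k, `[< star_colourable G k >].
Proof.
exists #|G|; apply/asboolP; exists enum_rank; split=> [u v uv|H].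
  by apply: contraTneq uv => /enum_rank_inj ->; rewrite edge_irrefl.
rewrite /bicoloured card_imset; last exact: enum_rank_inj.
move/eqP/cards2P => [a [b [ab SE]]] [_ Hc].
have [aS bS] : a \in sub_vertices H /\ b \in sub_vertices H.
  by rewrite SE !inE !eqxx orbT.
have eS x : sub_edge H x x = false.
  by apply/negP => /sub_edgeP /and3P[]; rewrite edge_irrefl.
have eab : sub_edge H a b.
  have /connectP [p] := Hc a b aS bS.
  case: p => [_ /= E|c p /= /andP[ac _] _]; first by rewrite E eqxx in ab.
  have /and3P[_ _] := sub_edgeP ac; rewrite SE !inE => /orP[]/eqP E.
    by rewrite E eS in ac.
  by rewrite -E.
exists a => // x y; rewrite SE !inE => /orP[]/eqP-> /orP[]/eqP->;
  by rewrite ?eS ?eqxx ?orbT ?andbT ?[sub_edge H b a]sub_edge_sym ?eab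
             ?ab ?[b == a]eq_sym ?ab.
Qed.

(* The least k such that [star_colourable G k]. *)
Definition star_chromatic_number (G : sgraph) : nat :=
  ex_minn (ex_star_colourable G).

(* Main.v *)
(** Call a neighbour [u] of [v] private when no other neighbour of [v] has the
    colour of [u].  In a star colouring every edge [uv] has [u] private at [v]
    or [v] private at [u], since otherwise it is the middle of a bicoloured P4;
    so the vertices have at least d/2 private neighbours on average.  But a
    vertex has at most k - 2 of them when d >= k: with k - 1, all its neighbours
    would be private.  Hence d/2 <= k - 2; and if d < k, then
    d + 4 <= 2d + 2 <= 2k. *)
Require Import Defs.
From mathcomp Require Import all_boot.
From mathcomp Require Import boolp.
From mathcomp Require Import zify.

Set Implicit Arguments.
Unset Strict Implicit.
Unset Printing Implicit Defensive.

Section InducedSubgraph.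

Variables (G : sgraph) (S : {set G}).

Definition induced_edge : rel G :=
  fun a b => [&& edge a b, a \in S & b \in S].

Lemma induced_edge_sym : symmetric induced_edge.
Proof. by move=> a b; rewrite /induced_edge edge_sym [(a \in S) && _]andbC. Qed.

Definition induced : subgraph G :=
  @Subgraph G S induced_edge induced_edge_sym (fun _ _ h => h).

End InducedSubgraph.

Section StarColouring.

Variables (G : sgraph) (k : nat) (f : G -> 'I_k).
Hypothesis f_star : star_colouring f.

(** The path [w], [x], [y], [z] induces a connected two-coloured subgraph, hence a star. The case
    [w = z] need not be listed, as the colours exclude it. *)
Lemma star_colouring_no_P4 (w x y z : G) :
  edge x w -> edge x y -> edge y z -> f w = f y -> f z = f x ->
  w = y \/ z = x.
Proof.
move=> xw xy yz fwy fzx.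
have [->|wy] := eqVneq w y; first by left.
have [->|zx] := eqVneq z x; first by right.
have [f_col f_sub] := f_star.
have fxy := f_col _ _ xy.
have neq_edge (a b : G) : edge a b -> a != b.
  by apply: contraTneq => ->; rewrite edge_irrefl.
pose S := [set w; x; y; z].
have [wS xS yS zS] : [/\ w \in S, x \in S, y \in S & z \in S].
  by rewrite !inE !eqxx !orbT.
have Sxw : induced_edge S x w by apply/and3P.
have Sxy : induced_edge S x y by apply/and3P.
have Syz : induced_edge S y z by apply/and3P.
have Sbi : bicoloured f (induced S).
  rewrite /bicoloured /= /S !imsetU !imset_set1 fwy fzx.
  suff -> : [set f y] :|: [set f x] :|: [set f y] :|: [set f x]
            = [set f x; f y] by rewrite cards2 fxy.
  by apply/setP => c; rewrite !inE; do 2?case: eqP.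
have Sconn : connected (induced S).
  have csym := sym_connect_sym (@induced_edge_sym G S).
  split=> [|a b aS bS /=]; first by apply/set0Pn; exists x.
  have to_x c : c \in S -> connect (induced_edge S) x c.
    rewrite !inE -!orbA => /or4P[] /eqP->; [exact: connect1 | exact: connect0 |
      exact: connect1 | exact: connect_trans (connect1 Sxy) (connect1 Syz)].
  by apply: connect_trans (to_x b bS); rewrite csym to_x.
have [c _ centre] := f_sub _ Sbi Sconn.
have := centre x w xS wS; have := centre x y xS yS; have := centre y z yS zS.
rewrite /= Sxw Sxy Syz.
have [[nxy nyz] nxw] := (neq_edge _ _ xy, neq_edge _ _ yz, neq_edge _ _ xw).
(* The centre is an end of each of [yz], [xy] and [xw]; every choice of ends identifies two vertices
   known to be distinct. *)
move=> /esym/andP[_ /orP[]/eqP E1] /esym/andP[_ /orP[]/eqP E2]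
       /esym/andP[_ /orP[]/eqP E3]; subst;
  by rewrite ?eqxx in wy zx nxy nyz nxw.
Qed.

Definition private_nbrs (v : G) : {set G} :=
  [set u | edge v u & [forall w, edge v w ==> (f w == f u) ==> (w == u)]].

Lemma private_nbrsP v u : u \in private_nbrs v ->
  edge v u /\ forall w, edge v w -> f w = f u -> w = u.
Proof.
rewrite inE => /andP[vu /forallP uU]; split=> // w vw fwu.
by have := uU w; rewrite vw fwu eqxx => /eqP.
Qed.

Lemma edge_private u v : edge v u ->
  (u \in private_nbrs v) || (v \in private_nbrs u).
Proof.
move=> vu; have uv : edge u v by rewrite edge_sym.
rewrite !inE vu uv /= -implyNb; apply/implyP => /forallPn[w].
rewrite !negb_imply => /and3P[vw /eqP fwu wu].
apply/forallP => z; apply/implyP => uz; apply/implyP => /eqP fzv.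
(* The path is [w], [v], [u], [z], where [w] witnesses that [u] is not private at [v]. *)
have [E|->//] := star_colouring_no_P4 vw vu uz fwu fzv.
by rewrite E eqxx in wu.
Qed.

(** Private neighbours have distinct colours other than [f v]. If they took all [k - 1] of these,
    every neighbour would share its colour with a private one and so equal it, making the degree
    less than [k]. *)
Lemma card_private_nbrs v : k <= #|[set u | edge v u]| ->
  #|private_nbrs v|.+2 <= k.
Proof.
move=> kd.
have injf : {in private_nbrs v &, injective f}.
  move=> a b /private_nbrsP[va _] /private_nbrsP[_ bU] E; exact: bU.
have sub : f @: private_nbrs v \subset [set~ f v].
  apply/subsetP => _ /imsetP[u /private_nbrsP[vu _] ->].
  by rewrite !inE eq_sym; exact: f_star.1.
have cC : #|[set~ f v]| = k.-1 by rewrite cardsC1 card_ord.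
have k0 : 0 < k by case: (f v) => m; case: (k).
have le1 := subset_leq_card sub; rewrite card_in_imset // cC in le1.
rewrite ltnNge; apply/negP => le2.
have /eqP im : f @: private_nbrs v == [set~ f v].
  by rewrite eqEcard sub card_in_imset // cC; lia.
suff /subset_leq_card : [set u | edge v u] \subset private_nbrs v by lia.
apply/subsetP => w; rewrite inE => vw.
have : f w \in [set~ f v] by rewrite !inE eq_sym; exact: f_star.1.
rewrite -im => /imsetP[u uU E].
by have [_ /(_ w vw E) ->] := private_nbrsP uU.
Qed.

Lemma sum_degree_le :
  \sum_(v : G) #|[set u | edge v u]| <= (\sum_v #|private_nbrs v|).*2.
Proof.
have cardE (A : {set G}) : #|A| = \sum_u (u \in A).
  by rewrite -sum1_card big_mkcond.
rewrite -addnn [X in _ <= X + _](eq_bigr _ (fun v _ => cardE (private_nbrs v))).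
rewrite [X in _ <= _ + X](eq_bigr _ (fun v _ => cardE (private_nbrs v))).
(* Swapping the sums in one copy puts the terms of [(v, u)] and [(u, v)] together, so [edge_private]
   bounds each summand. *)
rewrite [X in _ <= _ + X]exchange_big -big_split; apply: leq_sum => v _ /=.
rewrite cardE -big_split; apply: leq_sum => u _ /=.
rewrite inE; case vu: (edge v u) => //.
by have := edge_private vu; do 2!case: (_ \in _).
Qed.

End StarColouring.

Lemma star_colouring_degree (G : sgraph) d k (f : G -> 'I_k) :
  0 < #|G| -> 2 <= d -> regular G d -> star_colouring f -> d + 4 <= k.*2.
Proof.
move=> G0 d2 Greg f_star.
have [dk|kd] := ltnP d k; first lia.
have priv v : #|private_nbrs f v| <= k - 2.
  by have := card_private_nbrs f_star (v := v); rewrite Greg => /(_ kd); lia.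
(* This keeps [k - 2] from being truncated to 0 when [d <= (k - 2).*2] is turned into the goal. *)
have k2 : 2 <= k.
  have /card_gt0P[v _] := G0.
  by have := card_private_nbrs f_star (v := v); rewrite Greg => /(_ kd); lia.
have deg := sum_degree_le f_star.
rewrite (eq_bigr _ (fun v _ => Greg v)) sum_nat_const in deg.
have : \sum_v #|private_nbrs f v| <= #|G| * (k - 2).
  by rewrite -sum_nat_const; apply: leq_sum.
rewrite -leq_double doubleMr => /(leq_trans deg).
by rewrite leq_pmul2l //; lia.
Qed.

(* [uphalf n] is the ceiling of n / 2. *)
Theorem theorem1 (G : sgraph) (d : nat) (G_nonempty : 0 < #|G|)
  (d_ge2 : 2 <= d) (G_regular : regular G d) :
  uphalf (d + 4) <= star_chromatic_number G.
Proof.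
rewrite /star_chromatic_number; case: ex_minnP => k /asboolP[f f_star] _.
have := star_colouring_degree G_nonempty d_ge2 G_regular f_star.
by rewrite leq_uphalf_double.
Qed.
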